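(* Fix a frame $k$ and the values $Q_{su}(t_k)\ge 0$, $X_{su}(t_k)\ge 0$. Let $P_0^*$ be a solution of $$\text{maximize } Q_{su}(t_k)\,\mu_{su}(P_0)-X_{su}(t_k)\,P_0\quad\text{subject to } P_0\in\mathcal{P},$$ let $\theta^*=Q_{su}(t_k)\mu_{su}(P_0^* )-X_{su}(t_k)P_0^*$ be its optimal value, and let $P_1^*$ be a solution of $$\text{minimize } \frac{\theta^*+X_{su}(t_k)\,P_1}{\phi(P_1)}\quad\text{subject to } P_1\in\mathcal{P}.$$ Then the policy which in every slot $t$ of frame $k$ uses $$P(t)=\begin{cases}P_0^* & \text{if } Q_{pu}(t)=0,\\ P_1^* & \text{if } Q_{pu}(t)>0,\end{cases}$$ maximizes, over all policies for choosing the powers $P(t)\in\mathcal{P}$ during frame $k$, the ratio $$\frac{\mathbb{E}\left\{\sum_{t=t_k}^{t_{k+1}-1}\left(Q_{su}(t_k)\mu_{su}(t)-X_{su}(t_k)P(t)\right)\,\middle|\,\boldsymbol{Q}(t_k)\right\}}{\mathbb{E}\{T[k]\,|\,\boldsymbol{Q}(t_k)\}},\qquad \boldsymbol{Q}(t_k)=(Q_{su}(t_k),X_{su}(t_k)).$$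
   Context: Time is slotted. There is one primary user (PU) with queue $Q_{pu}(t)\in\{0,1,2,\dots\}$ and one secondary user (SU). PU arrivals $A_{pu}(t)$ are i.i.d. Bernoulli over slots with rate $\lambda_{pu}>0$. In every slot the SU chooses a power $P(t)\in\mathcal{P}$, where $\mathcal{P}\subseteq[0,P_{max}]$ contains $0$ and $P_{max}$; policies may be randomized and may depend on the past. - If $Q_{pu}(t)>0$ (PU busy), the PU transmits one packet and $P(t)$ is used for cooperative transmission: the PU transmission succeeds (random indicator $\mu_{pu}(P(t))\in\{0,1\}$) with probability $\phi(P(t))$, where $\phi$ is a known non-decreasing function on $\mathcal{P}$; a packet whose transmission fails stays in the queue. The SU cannot transmit its own data, so the SU service rate is $\mu_{su}(t)=0$. - If $Q_{pu}(t)=0$ (PU idle), $P(t)$ is used for the SU's own transmission, giving service rate $\mu_{su}(t)=\mu_{su}(P(t))$, where $\mu_{su}(\cdot)$ is a function on $\mathcal{P}$ with $0\le\mu_{su}(P)\le\mu_{max}<\infty$ and $\mu_{su}(0)=0$. The PU queue evolves as $Q_{pu}(t+1)=\max[Q_{pu}(t)-\mu_{pu}(P(t)),0]+A_{pu}(t)$, with $\mu_{pu}=0$ when the queue is empty. Arrivals and success/failure outcomes of PU transmissions (given the powers used) are mutually independent and independent over slots. With $\phi_{nc}=\phi(0)$ it is assumed that $\lambda_{pu}<\phi_{nc}$. Frame $k$ consists of the slots $t_k,\dots,t_{k+1}-1$ and has length $T[k]=t_{k+1}-t_k$. It starts at $t_k$ with $Q_{pu}(t_k)=0$, consists of a PU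 idle period ($Q_{pu}=0$) followed by a PU busy period ($Q_{pu}>0$), and $t_{k+1}$ is the first slot at which the PU becomes idle again after that busy period. $Q_{su}(t_k)$ and $X_{su}(t_k)$ (the SU queue backlog and the SU virtual power queue at the start of the frame) are nonnegative numbers held fixed as weights throughout the frame. *)

(* Defs.v *)
From HB Require Import structures.
From mathcomp Require Import all_boot all_order all_algebra.
From mathcomp Require Import all_classical all_reals all_analysis.

Set Implicit Arguments.
Unset Strict Implicit.
Unset Printing Implicit Defensive.

Import Order.TTheory GRing.Theory Num.Theory.
Local Open Scope classical_set_scope.
Local Open Scope ring_scope.

(* A frame is described on its own clock: slot 0 is the first slot t_k of the
   frame.  [Omega] carries the conditional law given the queue values at t_k,
   which therefore enter only as the real weights [q] and [x] below. *)

Section queue.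
Variable Omega : Type.
Variables (A S : nat -> Omega -> bool).

(* Subtraction on [nat] is truncated, i.e., max(Q - S, 0). *)
Fixpoint pu_queue (t : nat) (w : Omega) : nat :=
  if t is t'.+1 then (pu_queue t' w - S t' w + A t' w)%N else 0%N.

End queue.

(* A policy together with the system it drives.  [info t] is the sigma-algebra
   of everything on which the choice of [power t] may depend: the past (possibly
   including what happened before the frame) and any randomization of the
   policy.  [served] is the indicator of a successful PU transmission. *)
Record controlled_frame (R : realType) (PP : set R) (phi mu_su : R -> R)
    (lambda : R) (d : measure_display) (Omega : measurableType d)
    (Pr : probability Omega R) := ControlledFrame {
  info : nat -> set (set Omega);
  power : nat -> Omega -> R;
  arrival : nat -> Omega -> bool;
  served : nat -> Omega -> bool;
  info_sigma : forall t, sigma_algebra [set: Omega] (info t);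
  info_measurable : forall t, info t `<=` measurable;
  info_nondecreasing : forall t, info t `<=` info t.+1;
  power_adapted : forall t (B : set R), measurable B -> info t (power t @^-1` B);
  arrival_adapted : forall t, info t.+1 [set w | arrival t w];
  served_adapted : forall t, info t.+1 [set w | served t w];
  power_in : forall t w, PP (power t w);
  (* [mu_su] is an arbitrary function; the service rates it yields have to be
     random variables for the expected reward to make sense. *)
  rate_measurable : forall t, measurable_fun [set: Omega] (mu_su \o power t);
  served_idle : forall t w, pu_queue arrival served t w = 0%N -> served t w = false;
  (* Given [info t], the arrival and the transmission outcome of slot t are
     independent, with success probabilities lambda and phi (power t) (or 0 if
     the PU is idle). *)
  slot_law : forall t (E : set Omega) (a s : bool), info t E ->
    Pr (E `&` [set w | arrival t w = a /\ served t w = s]) =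
    ((bernoulli_pmf lambda a)%:E *
     \int[Pr]_(w in E)
       (bernoulli_pmf (if pu_queue arrival served t w == 0%N then 0
                       else phi (power t w)) s)%:E)%E
}.

(* Slot n is the first slot of the next frame if it is the least n satisfying
   this for the path [Q] of the PU queue. *)
Definition back_to_idle (Q : nat -> nat) (n : nat) : bool :=
  [&& (0 < n)%N, Q n == 0%N & (0 < Q n.-1)%N].

(* [None] if the busy period never ends. *)
Definition frame_end (Q : nat -> nat) : option nat :=
  if pselect (exists n, back_to_idle Q n) is left ex then Some (ex_minn ex)
  else None.

Section frame.
Variables (R : realType) (PP : set R) (phi mu_su : R -> R) (lambda : R).
Variables (d : measure_display) (Omega : measurableType d).
Variable Pr : probability Omega R.
Variable Z : controlled_frame PP phi mu_su lambda Pr.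

Definition Qpu (t : nat) (w : Omega) : nat :=
  pu_queue (arrival Z) (served Z) t w.

Definition frame_stop (w : Omega) : option nat := frame_end (Qpu ^~ w).

Definition in_frame (t : nat) (w : Omega) : Prop :=
  if frame_stop w is Some n then (t < n)%N else True.

Definition uses_stationary (P0 P1 : R) : Prop :=
  forall t w, in_frame t w ->
    power Z t w = if Qpu t w == 0%N then P0 else P1.

Definition frame_length (w : Omega) : \bar R :=
  if frame_stop w is Some n then n%:R%:E else +oo%E.

Definition su_rate (t : nat) (w : Omega) : R :=
  if Qpu t w == 0%N then mu_su (power Z t w) else 0.

(* The value 0 on unending frames is immaterial: lambda < phi 0 makes the frame
   length integrable, hence almost surely finite, under every policy. *)
Definition frame_reward (q x : R) (w : Omega) : R :=
  if frame_stop w is Some n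
  then \sum_(0 <= t < n) (q * su_rate t w - x * power Z t w) else 0.

Definition frame_ratio (q x : R) : \bar R :=
  ('E_Pr[frame_reward q x] / \int[Pr]_w frame_length w)%E.

End frame.

(* Main.v *)
Require Import Defs.
From HB Require Import structures.
From mathcomp Require Import all_boot all_order all_algebra.
From mathcomp Require Import ring lra zify.
From mathcomp Require Import all_classical all_reals all_analysis.
From mathcomp Require Import measurable_realfun.

Set Implicit Arguments.
Unset Strict Implicit.
Unset Printing Implicit Defensive.

Import Order.TTheory GRing.Theory Num.Theory.
Import numFieldNormedType.Exports.
Local Open Scope classical_set_scope.
Local Open Scope ring_scope.

(** Why the stationary policy is optimal.  Put
      c = (theta + x P1) / phi(P1)   and   rho = theta - c lambda.
    In a slot of the frame, compare the reward with theta while giving a credit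
    c for every expected PU departure: the gain
      reward - theta + c (probability of a departure)
    is at most 0 for every power.  If the PU is idle this is the optimality of
    P0; if it is busy the gain is -x p - theta + c phi(p), and its sign is the
    optimality of P1.  The powers P0 and P1 make the gain vanish.

    On the other hand the PU queue is empty at both ends of the frame, so a
    frame has as many departures as arrivals.  The expected number of arrivals
    is lambda E[T] under every policy, hence so is the expected number of
    departures.  Summing the gains over the frame,
      E[reward] - theta E[T] + c lambda E[T] = E[reward] - rho E[T]
    is therefore at most 0 for every policy and equal to 0 for the stationary
    one: rho is the optimal ratio.

    Two points need care.  The length T is a stopping time, so the sums are
    first cut at a slot n, using that membership of slot t in the frame is known
    at the start of slot t ([info_alive]); the cut is then removed by dominated
    convergence with a multiple of T as the bound ([frame_reward_balance]).
    This requires E[T] < oo ([frame_length_integrable]).  The departures in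
    busy slots have rate at least phi(0) > lambda, and at most one arrival falls
    in the idle slots of a frame; together they bound the expected length cut at
    n by phi(0) / (lambda (phi(0) - lambda)) ([expected_length_le]). *)

(** * Events of a sigma-algebra *)

Section sigma_algebra_theory.
Variables (T : Type) (G : set (set T)).
Hypothesis sG : sigma_algebra [set: T] G.

Lemma sigma_algebraC (A : set T) : G A -> G (~` A).
Proof. by case: sG => _ GC _ /GC; rewrite setTD. Qed.

Lemma sigma_algebraU (A B : set T) : G A -> G B -> G (A `|` B).
Proof.
case: sG => G0 _ GU GA GB; rewrite -bigcup2E; apply: GU.
by case=> [|[|n]].
Qed.

Lemma sigma_algebraI (A B : set T) : G A -> G B -> G (A `&` B).
Proof.
move=> GA GB; rewrite -[X in G X]setCK setCI; apply: sigma_algebraC.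
by apply: sigma_algebraU; exact: sigma_algebraC.
Qed.

Lemma sigma_algebraT : G [set: T].
Proof. by rewrite -setC0; apply: sigma_algebraC; case: sG. Qed.

End sigma_algebra_theory.

(** * Sample paths of a frame *)

Section frame_paths.
Variables (R : realType) (PP : set R) (phi mu_su : R -> R) (lambda : R).
Variables (d : measure_display) (Omega : measurableType d).
Variable Pr : probability Omega R.
Variable Z : controlled_frame PP phi mu_su lambda Pr.

Definition same_history (t : nat) (v w : Omega) : Prop :=
  forall i, (i < t)%N -> arrival Z i v = arrival Z i w /\
                         served Z i v = served Z i w.

(** Induction on [t]: the last slot splits [E] according to the four values of
    its arrival and its service, and on each piece what remains to be tested
    concerns the previous slots only. *)
Lemma history_event (t : nat) (E : set Omega) :
  (forall v w, same_history t v w -> E v -> E w) -> info Z t E.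
Proof.
elim: t E => [|t IH] E hE.
  have [[v Ev]|nE] := pselect (exists v, E v).
    rewrite (_ : E = setT); first exact: sigma_algebraT (info_sigma Z 0).
    by apply/seteqP; split=> // w _; exact: hE Ev.
  rewrite (_ : E = set0); first by case: (info_sigma Z 0).
  by apply/seteqP; split=> // w Ew; apply: nE; exists w.
have sG := info_sigma Z t.+1.
(* The part of [E] on which the last slot has arrival [a] and service [s]. *)
pose F (a s : bool) := [set w | arrival Z t w = a] `&`
  ([set w | served Z t w = s] `&`
   [set w | exists v, [/\ same_history t v w, arrival Z t v = a,
                          served Z t v = s & E v]]).
have GF a s : info Z t.+1 (F a s).
  apply: (sigma_algebraI sG).
    have GA := arrival_adapted Z t; case: a => //.
    rewrite (_ : [set _ | _] = ~` [set w | arrival Z t w]).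
      exact: (sigma_algebraC sG).
    by apply/seteqP; split=> w /=; [move=> ->|move/negP/negbTE].
  apply: (sigma_algebraI sG).
    have GS := served_adapted Z t; case: s => //.
    rewrite (_ : [set _ | _] = ~` [set w | served Z t w]).
      exact: (sigma_algebraC sG).
    by apply/seteqP; split=> w /=; [move=> ->|move/negP/negbTE].
  apply/info_nondecreasing/IH => v w vw [u [uv ua us Eu]].
  exists u; split=> // i it; have [-> ->] := uv i it; exact: vw.
rewrite (_ : E = (F true true `|` F true false) `|`
                 (F false true `|` F false false)).
  by do 2?apply: (sigma_algebraU sG).
apply/seteqP; split=> [w Ew|w]; last first.
  have step a s : F a s w -> E w.
    case=> /= wa [/= ws [v [vw va vs Ev]]]; apply: hE Ev => i.
    rewrite ltnS leq_eqVlt => /predU1P[->|/vw//].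
    by rewrite wa ws va vs.
  by case=> [] []; exact: step.
have Fw : F (arrival Z t w) (served Z t w) w by do 2!split=> //; exists w.
by move: Fw; case: arrival; case: served => Fw;
  [left; left|left; right|right; left|right; right].
Qed.

Lemma same_history_Qpu (t i : nat) (v w : Omega) :
  same_history t v w -> (i <= t)%N -> Qpu Z i v = Qpu Z i w.
Proof.
move=> vw; elim: i => // i IH it.
rewrite /Qpu/= -!/(Qpu _ _ _) (IH (ltnW it)).
by have [-> ->] := vw i it.
Qed.

Definition alive (t : nat) (w : Omega) : bool := `[< in_frame Z t w >].
Definition idle (t : nat) (w : Omega) : bool := Qpu Z t w == 0%N.

Lemma in_frameP (t : nat) (w : Omega) :
  in_frame Z t w <->
  forall n, (n <= t)%N -> ~~ back_to_idle (Qpu Z ^~ w) n.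
Proof.
rewrite /in_frame /frame_stop /frame_end.
case: pselect => [ex|nex]; last first.
  by split=> // _ n _; apply/negP => bn; apply: nex; exists n.
case: ex_minnP => m bm mmin; split=> [tm n nt|h].
  by apply/negP => /mmin; rewrite leqNgt (leq_ltn_trans nt).
by rewrite ltnNge; apply/negP => /h; rewrite bm.
Qed.

Lemma info_alive (t : nat) : info Z t [set w | alive t w].
Proof.
apply: history_event => v w vw /asboolP/in_frameP al.
apply/asboolP/in_frameP => n nt; move: (al n nt).
by rewrite /back_to_idle !(same_history_Qpu vw)// (leq_trans (leq_pred n)).
Qed.

Lemma info_idle (t : nat) : info Z t [set w | idle t w].
Proof.
by apply: history_event => v w vw; rewrite /= /idle (same_history_Qpu vw).
Qed.

Lemma info_alive_idle (t : nat) : info Z t [set w | alive t w && idle t w].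
Proof.
rewrite (_ : [set _ | _] = [set w | alive t w] `&` [set w | idle t w]).
  exact: sigma_algebraI (info_sigma Z t) _ _ (info_alive t) (info_idle t).
by apply/seteqP; split=> w /= /andP.
Qed.

Lemma alive0 (w : Omega) : alive 0 w.
Proof. by apply/asboolP/in_frameP => n; rewrite leqn0 => /eqP->. Qed.

(** The frame ends when a busy slot is followed by an idle one; this recursion
    replaces the minimum in the definition of the end of the frame. *)
Lemma aliveS (t : nat) (w : Omega) :
  alive t.+1 w = alive t w && ~~ (idle t.+1 w && ~~ idle t w).
Proof.
apply/asboolP/andP => [/in_frameP al|[/asboolP/in_frameP al nb]].
  split; first by apply/asboolP/in_frameP => n nt; exact/al/leqW.
  by move: (al t.+1 (leqnn _)); rewrite /back_to_idle/= lt0n.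
apply/in_frameP => n; rewrite leq_eqVlt => /predU1P[->|/al//].
by rewrite /back_to_idle/= lt0n.
Qed.

(** Conservation of packets without truncated subtraction: nothing is served
    from an empty queue. *)
Lemma QpuS (t : nat) (w : Omega) :
  (Qpu Z t.+1 w + served Z t w)%N = (Qpu Z t w + arrival Z t w)%N.
Proof.
have := @served_idle _ _ _ _ _ _ _ _ Z t w.
rewrite /Qpu/= -/(Qpu Z t w); case: (served Z t w); last by lia.
by case: (Qpu Z t w) => [/(_ erefl)//|k _]; lia.
Qed.

(** Arrivals minus departures telescope to the backlog, and once the frame is
    over both sides have become 0, since the frame ends with an empty queue. *)
Lemma frame_flow (n : nat) (w : Omega) :
  \sum_(0 <= t < n) (alive t w)%:R * ((arrival Z t w)%:R - (served Z t w)%:R)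
  = (alive n w)%:R * (Qpu Z n w)%:R :> R.
Proof.
elim: n => [|n IH]; first by rewrite big_nil mulr0.
rewrite big_nat_recr// IH aliveS /idle.
have := QpuS n w; move: (Qpu Z n.+1 w) (Qpu Z n w) => Q' Q.
move/(congr1 (fun k : nat => k%:R : R)); rewrite !natrD => QS.
case: (alive n w); last by rewrite /= !mul0r addr0.
case: (Q =P 0%N) => [_|_]; rewrite ?andbF ?andbT /=; first lra.
by case: (Q' =P 0%N) => [Q0|_]; rewrite ?Q0 /= in QS *; lra.
Qed.

(** An arrival in an idle slot starts the busy period, and the frame ends with
    that period: only the last idle slot of a frame can have an arrival. *)
Lemma idle_arrivals_le1 (n : nat) (w : Omega) :
  \sum_(0 <= t < n) (alive t w && idle t w)%:R * (arrival Z t w)%:R <= 1 :> R.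
Proof.
(* The extra term records that no arrival has occurred while still idle. *)
suff : \sum_(0 <= t < n) (alive t w && idle t w)%:R * (arrival Z t w)%:R
       + (alive n w && idle n w)%:R <= 1 :> R.
  by apply: le_trans; rewrite lerDl.
elim: n => [|n IH]; first by rewrite big_nil add0r; case: (_ && _).
rewrite big_nat_recr// aliveS /idle; move: IH.
have := @served_idle _ _ _ _ _ _ _ _ Z n w; rewrite /idle -/(Qpu Z n w).
have := QpuS n w; move: (Qpu Z n.+1 w) (Qpu Z n w) => Q' Q.
case: (alive n w) => /=; last by move=> _ _ sum_le1; lra.
case: (Q =P 0%N) => [-> QS /(_ erefl) s0|_ _ _]; rewrite /= ?andbF ?andbT.
  move: QS; rewrite s0 addn0 add0n => ->; rewrite mul1r.
  by case: (arrival Z n w); rewrite /=; lra.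
by move=> sum_le1; case: (Q' == 0%N); rewrite /= mul0r; lra.
Qed.

End frame_paths.

(** * Expectations of bounded random variables *)

Section bounded_random_variables.
Variables (R : realType) (d : measure_display) (Omega : measurableType d).
Variable Pr : probability Omega R.
Implicit Types f g : Omega -> R.

Definition bounded_rv f : Prop :=
  measurable_fun [set: Omega] f /\ exists K, forall w, `|f w| <= K.

Lemma bounded_rv_integrable f :
  bounded_rv f -> Pr.-integrable [set: Omega] (EFin \o f).
Proof.
move=> [mf [K fK]]; apply: measurable_bounded_integrable => //.
  exact: le_lt_trans (probability_le1 Pr measurableT) (ltry 1).
exists K; split; first exact: num_real.
by move=> M KM w _; exact: le_trans (fK w) (ltW KM).
Qed.

Lemma bounded_rv_cst (k : R) : bounded_rv (fun=> k).
Proof. by split; [exact: measurable_cst | exists `|k|]. Qed.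

Lemma bounded_rvD f g :
  bounded_rv f -> bounded_rv g -> bounded_rv (fun w => f w + g w).
Proof.
move=> [mf [K fK]] [mg [L gL]]; split; first exact: measurable_funD.
by exists (K + L) => w; rewrite (le_trans (ler_normD _ _))// lerD.
Qed.

Lemma bounded_rvM f g :
  bounded_rv f -> bounded_rv g -> bounded_rv (fun w => f w * g w).
Proof.
move=> [mf [K fK]] [mg [L gL]]; split; first exact: measurable_funM.
by exists (K * L) => w; rewrite normrM ler_pM.
Qed.

Lemma bounded_rvZ (k : R) f : bounded_rv f -> bounded_rv (fun w => k * f w).
Proof. exact/bounded_rvM/bounded_rv_cst. Qed.

Lemma bounded_rvB f g :
  bounded_rv f -> bounded_rv g -> bounded_rv (fun w => f w - g w).
Proof.
move=> bf bg; have := bounded_rvD bf (bounded_rvZ (-1) bg).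
by under eq_fun do rewrite mulN1r.
Qed.

Lemma bounded_rv_sum (h : nat -> Omega -> R) (n : nat) :
  (forall t, bounded_rv (h t)) -> bounded_rv (fun w => \sum_(0 <= t < n) h t w).
Proof.
move=> bh; elim: n => [|n IH].
  by under eq_fun do rewrite big_nil; exact: bounded_rv_cst.
by under eq_fun do rewrite big_nat_recr//=; exact: bounded_rvD.
Qed.

Lemma bounded_rv_bool (b : Omega -> bool) :
  measurable [set w | b w] -> bounded_rv (fun w => (b w)%:R).
Proof.
move=> mb; split; last first.
  by exists 1 => w; case: (b w); rewrite ?normr1 ?normr0.
rewrite (_ : (fun w => (b w)%:R) = \1_[set w | b w]) //.
by apply/funext => w; rewrite indicE mem_setE.
Qed.

Lemma RintegralT_D f g : bounded_rv f -> bounded_rv g ->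
  \int[Pr]_w (f w + g w) = \int[Pr]_w f w + \int[Pr]_w g w.
Proof. by move=> bf bg; rewrite RintegralD//; exact: bounded_rv_integrable. Qed.

Lemma RintegralT_Z (k : R) f : bounded_rv f ->
  \int[Pr]_w (k * f w) = k * \int[Pr]_w f w.
Proof. by move=> bf; rewrite RintegralZl//; exact: bounded_rv_integrable. Qed.

Lemma RintegralT_B f g : bounded_rv f -> bounded_rv g ->
  \int[Pr]_w (f w - g w) = \int[Pr]_w f w - \int[Pr]_w g w.
Proof. by move=> bf bg; rewrite RintegralB//; exact: bounded_rv_integrable. Qed.

Lemma RintegralT_sum (h : nat -> Omega -> R) (n : nat) :
  (forall t, bounded_rv (h t)) ->
  \int[Pr]_w (\sum_(0 <= t < n) h t w) = \sum_(0 <= t < n) \int[Pr]_w h t w.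
Proof.
move=> bh; elim: n => [|n IH].
  under eq_Rintegral do rewrite big_nil.
  by rewrite big_nil Rintegral_cst// mul0r.
under eq_Rintegral do rewrite big_nat_recr//=.
by rewrite RintegralT_D ?IH ?big_nat_recr//; exact: bounded_rv_sum.
Qed.

Lemma RintegralT_cst (k : R) : \int[Pr]_w k = k.
Proof.
rewrite Rintegral_cst// -[RHS]mulr1; congr (_ * _).
by have := congr1 fine (probability_setT Pr).
Qed.

Lemma RintegralT_le f g : bounded_rv f -> bounded_rv g ->
  (forall w, f w <= g w) -> \int[Pr]_w f w <= \int[Pr]_w g w.
Proof.
by move=> bf bg fg; apply: le_Rintegral => //; exact: bounded_rv_integrable.
Qed.

Lemma Rintegral_bool (b : Omega -> bool) : measurable [set w | b w] ->
  \int[Pr]_w (b w)%:R = fine (Pr [set w | b w]).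
Proof.
move=> mb; rewrite /Rintegral -[in RHS](setIT [set w | b w]).
rewrite -(integral_indic _ measurableT)//; congr fine.
by apply: eq_integral => w _; rewrite indicE mem_setE.
Qed.

End bounded_random_variables.

(** Monotonicity on [PP], an arbitrary set of reals, suffices: a superlevel set
    of [phi] in [PP] is the trace on [PP] of an up-closed set of reals, which is
    an interval. *)
Lemma measurable_monotone_comp (R : realType) (PP : set R) (phi : R -> R)
    (d : measure_display) (T : measurableType d) (p : T -> R) :
  (forall u v, PP u -> PP v -> u <= v -> phi u <= phi v) ->
  (forall w, PP (p w)) -> measurable_fun [set: T] p ->
  measurable_fun [set: T] (phi \o p).
Proof.
move=> phi_nd PPp mp.
apply: (measurability _ (RGenOInfty.measurableE R)) => _ [_ [c ->] <-].
rewrite setTI preimage_itvoy.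
pose U : set R := [set v | exists u, [/\ PP u, u <= v & c < phi u]].
have mU : measurable U.
  apply: is_interval_measurable => u v [z [PPz zu cz]] _ y /andP[uy _].
  by exists z; split=> //; exact: le_trans uy.
rewrite (_ : [set _ | _] = p @^-1` U).
  by rewrite -[_ @^-1` _]setTI; exact: mp.
apply/seteqP; split=> w /=; first by move=> cw; exists (p w).
by move=> [u [PPu up cu]]; exact: lt_le_trans (phi_nd _ _ PPu (PPp w) up).
Qed.

(** * Expected arrivals and departures of a slot *)

Section slot_expectations.
Variables (R : realType) (PP : set R) (phi mu_su : R -> R) (lambda : R).
Variables (d : measure_display) (Omega : measurableType d).
Variable Pr : probability Omega R.
Variable Z : controlled_frame PP phi mu_su lambda Pr.
Hypothesis phi_prob : forall p, PP p -> 0 <= phi p <= 1.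
Hypothesis phi_nondecreasing :
  forall p p', PP p -> PP p' -> p <= p' -> phi p <= phi p'.

Definition service_prob (t : nat) (w : Omega) : R :=
  if idle Z t w then 0 else phi (power Z t w).

Lemma measurable_power (t : nat) : measurable_fun [set: Omega] (power Z t).
Proof.
by move=> _ B mB; rewrite setTI; apply/info_measurable/power_adapted.
Qed.

Lemma measurable_idle (t : nat) : measurable [set w | idle Z t w].
Proof. exact/info_measurable/info_idle. Qed.

Lemma measurable_alive (t : nat) : measurable [set w | alive Z t w].
Proof. exact/info_measurable/info_alive. Qed.

Lemma measurable_arrival (t : nat) : measurable [set w | arrival Z t w].
Proof. exact/info_measurable/arrival_adapted. Qed.

Lemma measurable_served (t : nat) : measurable [set w | served Z t w].
Proof. exact/info_measurable/served_adapted. Qed.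

Lemma service_prob01 (t : nat) (w : Omega) : 0 <= service_prob t w <= 1.
Proof.
rewrite /service_prob; case: ifP => _; first by rewrite lexx ler01.
by apply: phi_prob; exact: power_in.
Qed.

Lemma bounded_service_prob (t : nat) : bounded_rv (service_prob t).
Proof.
split; last first.
  by exists 1 => w; have /andP[? ?] := service_prob01 t w; rewrite ger0_norm.
apply: measurable_fun_ifT => //.
- by apply: (measurable_fun_bool true); rewrite setTI; exact: measurable_idle.
- exact: measurable_monotone_comp (power_in Z t) (measurable_power t).
Qed.

Lemma slot_law_service (t : nat) (E : set Omega) (a s : bool) : info Z t E ->
  Pr (E `&` [set w | arrival Z t w = a /\ served Z t w = s]) =
  ((bernoulli_pmf lambda a)%:E *
   \int[Pr]_(w in E) (bernoulli_pmf (service_prob t w) s)%:E)%E.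
Proof. exact: slot_law. Qed.

Lemma bounded_pmf (t : nat) (s : bool) :
  bounded_rv (fun w => bernoulli_pmf (service_prob t w) s).
Proof.
have bs := bounded_service_prob t; case: s => //=.
exact/bounded_rvB/bs/bounded_rv_cst.
Qed.

Lemma measurable_slot (t : nat) (a s : bool) :
  measurable [set w | (arrival Z t w == a) && (served Z t w == s)].
Proof.
have mb (f : Omega -> bool) (c : bool) :
    measurable [set w | f w] -> measurable [set w | f w == c].
  move=> mf; case: c; first by under eq_set do rewrite eqb_id.
  rewrite (_ : [set _ | _] = ~` [set w | f w]); first exact: measurableC.
  by apply/seteqP; split=> w /=; case: (f w).
rewrite (_ : [set _ | _] =
  [set w | arrival Z t w == a] `&` [set w | served Z t w == s]).
  by apply: measurableI; apply: mb;
    [exact: measurable_arrival|exact: measurable_served].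
by apply/seteqP; split=> w /= /andP.
Qed.

(** The law of a slot as an identity between expectations, [b] being an event
    decided before the slot.  The two lemmas that follow are its marginals. *)
Lemma Rintegral_slot (t : nat) (b : Omega -> bool) (a s : bool) :
  info Z t [set w | b w] ->
  \int[Pr]_w ((b w)%:R * ((arrival Z t w == a) && (served Z t w == s))%:R) =
  bernoulli_pmf lambda a *
  \int[Pr]_w ((b w)%:R * bernoulli_pmf (service_prob t w) s).
Proof.
move=> ib; have mb := info_measurable ib.
under eq_Rintegral do rewrite -natrM mulnb.
rewrite Rintegral_bool; last first.
  have := measurableI _ _ mb (measurable_slot t a s).
  by congr measurable; apply/seteqP; split=> w /= /andP.
rewrite (_ : [set _ | _] =
  [set w | b w] `&` [set w | arrival Z t w = a /\ served Z t w = s]);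
  last first.
  apply/seteqP; split=> w /= => [/and3P[? /eqP ? /eqP ?]//|[-> [-> ->]]].
  by rewrite !eqxx.
rewrite slot_law_service// fineM//; last first.
  apply: integrable_fin_num => //.
  by apply: integrableS (bounded_rv_integrable Pr (bounded_pmf t s)).
congr (_ * fine _); rewrite [LHS]integral_mkcond; apply: eq_integral => w _.
by rewrite patchE mem_setE unfold_in; case: (b w); rewrite ?mul1r ?mul0r.
Qed.

Lemma Rintegral_arrival (t : nat) (b : Omega -> bool) :
  info Z t [set w | b w] ->
  \int[Pr]_w ((b w)%:R * (arrival Z t w)%:R) = lambda * \int[Pr]_w (b w)%:R.
Proof.
move=> ib; have bb := bounded_rv_bool R (info_measurable ib).
have bslot a s := bounded_rvM bb (bounded_rv_bool R (measurable_slot t a s)).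
have bpmf s := bounded_rvM bb (bounded_pmf t s).
transitivity (\int[Pr]_w (
    (b w)%:R * ((arrival Z t w == true) && (served Z t w == true))%:R +
    (b w)%:R * ((arrival Z t w == true) && (served Z t w == false))%:R)).
  apply: eq_Rintegral => w _; rewrite -mulrDr.
  by case: arrival; case: served; rewrite /= ?addr0 ?add0r.
rewrite RintegralT_D// !Rintegral_slot// -mulrDr.
rewrite -(RintegralT_D Pr (bpmf true) (bpmf false)).
by congr (_ * _); apply: eq_Rintegral => w _; rewrite -mulrDr subrKC mulr1.
Qed.

Lemma Rintegral_served (t : nat) (b : Omega -> bool) :
  info Z t [set w | b w] ->
  \int[Pr]_w ((b w)%:R * (served Z t w)%:R) =
  \int[Pr]_w ((b w)%:R * service_prob t w).
Proof.
move=> ib; have bb := bounded_rv_bool R (info_measurable ib).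
have bslot a s := bounded_rvM bb (bounded_rv_bool R (measurable_slot t a s)).
transitivity (\int[Pr]_w (
    (b w)%:R * ((arrival Z t w == true) && (served Z t w == true))%:R +
    (b w)%:R * ((arrival Z t w == false) && (served Z t w == true))%:R)).
  apply: eq_Rintegral => w _; rewrite -mulrDr.
  by case: arrival; case: served; rewrite /= ?addr0 ?add0r.
by rewrite RintegralT_D// !Rintegral_slot// -mulrDl /= subrKC mul1r.
Qed.

End slot_expectations.

(** * Expected length of a frame *)

Section frame_integrals.
Variables (R : realType) (PP : set R) (Pmax : R) (phi mu_su : R -> R).
Variables (mu_max lambda : R).
Hypothesis PP_bounded : forall p, PP p -> 0 <= p <= Pmax.
Hypothesis PP_0 : PP 0.
Hypothesis phi_prob : forall p, PP p -> 0 <= phi p <= 1.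
Hypothesis phi_nondecreasing :
  forall p p', PP p -> PP p' -> p <= p' -> phi p <= phi p'.
Hypothesis mu_su_bounded : forall p, PP p -> 0 <= mu_su p <= mu_max.
Hypotheses (lambda_gt0 : 0 < lambda) (lambda_lt : lambda < phi 0).
Variables (d : measure_display) (Omega : measurableType d).
Variable Pr : probability Omega R.
Variable Z : controlled_frame PP phi mu_su lambda Pr.

Local Notation alive := (alive Z).
Local Notation idle := (idle Z).
Local Notation service_prob := (service_prob Z).

Lemma bounded_alive (t : nat) : bounded_rv (fun w => (alive t w)%:R : R).
Proof. exact/bounded_rv_bool/measurable_alive. Qed.

Lemma bounded_arrival (t : nat) : bounded_rv (fun w => (arrival Z t w)%:R : R).
Proof. exact/bounded_rv_bool/measurable_arrival. Qed.

Lemma bounded_served (t : nat) : bounded_rv (fun w => (served Z t w)%:R : R).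
Proof. exact/bounded_rv_bool/measurable_served. Qed.

Lemma bounded_flow (t : nat) : bounded_rv
  (fun w => (alive t w)%:R * ((arrival Z t w)%:R - (served Z t w)%:R) : R).
Proof.
apply: bounded_rvM (bounded_alive t) _.
exact: bounded_rvB (bounded_arrival t) (bounded_served t).
Qed.

Lemma bounded_alive_service (t : nat) :
  bounded_rv (fun w => (alive t w)%:R * service_prob t w).
Proof.
by apply: bounded_rvM (bounded_alive t) _; exact: bounded_service_prob.
Qed.

Lemma Rintegral_flow (t : nat) :
  \int[Pr]_w ((alive t w)%:R * ((arrival Z t w)%:R - (served Z t w)%:R)) =
  lambda * \int[Pr]_w (alive t w)%:R -
  \int[Pr]_w ((alive t w)%:R * service_prob t w).
Proof.
have balive := bounded_alive t.
rewrite -(Rintegral_served phi_prob phi_nondecreasing (info_alive Z t)).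
rewrite -(Rintegral_arrival phi_prob phi_nondecreasing (info_alive Z t)).
rewrite -RintegralT_B.
- by apply: eq_Rintegral => w _; rewrite mulrBr.
- exact: bounded_rvM (bounded_arrival t).
- exact: bounded_rvM (bounded_served t).
Qed.

Lemma service_prob_ge (t : nat) (w : Omega) :
  ~~ idle t w -> phi 0 <= service_prob t w.
Proof.
move=> /negbTE ni; rewrite /service_prob ni.
have Pt := power_in Z t w.
by apply: phi_nondecreasing => //; case/andP: (PP_bounded Pt).
Qed.

(** Write s for the expected service of a slot of the frame and i for the
    probability that the slot is in the frame and idle: then
    phi(0) P(alive) <= s + phi(0) i.  By [Rintegral_flow] this bounds
    (phi(0) - lambda) P(alive) by the expected decrease of the queue plus
    phi(0) i, and lambda i is the expected number of arrivals in an idle slot.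
    Summed over the slots, the decrease is at most 0 ([frame_flow]: the queue
    starts empty) and the idle arrivals are at most 1 ([idle_arrivals_le1]). *)
Lemma expected_length_le (n : nat) :
  lambda * (phi 0 - lambda) * \sum_(0 <= t < n) \int[Pr]_w (alive t w)%:R
  <= phi 0.
Proof.
have phi0_gt0 : 0 < phi 0 by exact: lt_trans lambda_lt.
have bidle t : bounded_rv (fun w => (alive t w && idle t w)%:R : R).
  exact/bounded_rv_bool/info_measurable/info_alive_idle.
have barr t : bounded_rv
    (fun w => (alive t w && idle t w)%:R * (arrival Z t w)%:R : R).
  exact: bounded_rvM (bidle t) (bounded_arrival t).
have flow_ge0 : 0 <= \sum_(0 <= t < n) \int[Pr]_w
    ((alive t w)%:R * ((arrival Z t w)%:R - (served Z t w)%:R)).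
  rewrite -(RintegralT_sum _ _ bounded_flow).
  apply: Rintegral_ge0 => w _; rewrite frame_flow.
  by rewrite mulr_ge0// ler0n.
have idle_le1 : \sum_(0 <= t < n) \int[Pr]_w
    ((alive t w && idle t w)%:R * (arrival Z t w)%:R) <= 1.
  rewrite -(RintegralT_sum _ _ barr).
  have := RintegralT_le Pr (bounded_rv_sum n barr) (bounded_rv_cst _ 1)
    (idle_arrivals_le1 Z n).
  by rewrite RintegralT_cst.
have step t : lambda * (phi 0 - lambda) * \int[Pr]_w (alive t w)%:R <=
    - lambda * \int[Pr]_w
      ((alive t w)%:R * ((arrival Z t w)%:R - (served Z t w)%:R)) +
    phi 0 * \int[Pr]_w ((alive t w && idle t w)%:R * (arrival Z t w)%:R).
  rewrite Rintegral_flow.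
  rewrite (Rintegral_arrival phi_prob phi_nondecreasing (info_alive_idle Z t)).
  have : phi 0 * \int[Pr]_w (alive t w)%:R <=
      \int[Pr]_w ((alive t w)%:R * service_prob t w) +
      phi 0 * \int[Pr]_w (alive t w && idle t w)%:R.
    have bs := bounded_alive_service t.
    have ba := bounded_alive t.
    rewrite -!RintegralT_Z// -RintegralT_D//; last exact: bounded_rvZ.
    apply: RintegralT_le; first exact: bounded_rvZ.
      exact: bounded_rvD bs (bounded_rvZ _ (bidle t)).
    move=> w; case: (alive t w); rewrite /= ?mulr0 ?mul0r ?addr0// mul1r mulr1.
    have [|ni] := boolP (idle t w).
      by have /andP[s0 _] := service_prob01 Z phi_prob t w; rewrite mulr1 lerDr.
    by rewrite mulr0 addr0; exact: service_prob_ge.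
  move/(ler_wpM2l (ltW lambda_gt0)).
  move: (\int[Pr]_w _) (\int[Pr]_w _) (\int[Pr]_w _) => a s i.
  by move=> lambda_mul; lra.
rewrite mulr_sumr; apply: (le_trans (ler_sum _ (fun t _ => step t))).
rewrite big_split/= -!mulr_sumr mulNr -[leRHS]mulr1 -[leRHS]add0r.
by rewrite lerD ?oppr_le0 ?ler_pM2l// mulr_ge0// ltW.
Qed.

Lemma alive_stop (t n : nat) (w : Omega) :
  frame_stop Z w = Some n -> alive t w = (t < n)%N.
Proof. by rewrite /alive /in_frame => ->; rewrite asboolb. Qed.

Lemma frame_sum (h : nat -> R) (m n : nat) (w : Omega) :
  frame_stop Z w = Some m -> (m <= n)%N ->
  \sum_(0 <= t < n) (alive t w)%:R * h t = \sum_(0 <= t < m) h t.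
Proof.
move=> wm mn; rewrite (big_cat_nat (leq0n m) mn)//= [X in _ + X]big_nat_cond.
rewrite [X in _ + X]big1 ?addr0; last first.
  by move=> t /andP[/andP[mt _] _]; rewrite (alive_stop _ wm) ltnNge mt mul0r.
rewrite !big_nat; apply: eq_bigr => t /andP[_ tm].
by rewrite (alive_stop _ wm) tm mul1r.
Qed.

(** The minimum of [n] and the frame length. *)
Definition truncated_length (n : nat) (w : Omega) : R :=
  \sum_(0 <= t < n) (alive t w)%:R.

Lemma truncated_length_stop (m n : nat) (w : Omega) :
  frame_stop Z w = Some m -> (m <= n)%N -> truncated_length n w = m%:R.
Proof.
move=> wm mn; rewrite /truncated_length.
under eq_bigr do rewrite -[_%:R]mulr1.
by rewrite (frame_sum _ wm mn) sumr_const_nat subn0.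
Qed.

Lemma truncated_length_cvg (w : Omega) :
  (truncated_length n w)%:E @[n --> \oo] --> frame_length Z w.
Proof.
rewrite /frame_length; case wm : (frame_stop Z w) => [m|].
  apply: cvg_near_cst; near=> n; rewrite (truncated_length_stop wm)//.
  by near: n; exact: nbhs_infty_ge.
have -> : (fun n => (truncated_length n w)%:E) = (fun n => n%:R%:E).
  apply/funext => n; rewrite /truncated_length; congr EFin.
  under eq_bigr do rewrite /alive /in_frame wm asboolT//.
  by rewrite sumr_const_nat subn0.
exact/cvgeryP/cvgr_idn.
Unshelve. all: by end_near. Qed.

Lemma bounded_truncated_length (n : nat) : bounded_rv (truncated_length n).
Proof. exact: bounded_rv_sum bounded_alive. Qed.

Lemma truncated_length_nd (w : Omega) :
  {homo (fun n => (truncated_length n w)%:E) : m n / (m <= n)%N >-> (m <= n)%E}.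
Proof.
move=> m n mn; rewrite lee_fin /truncated_length.
rewrite (big_cat_nat (leq0n m) mn)//= lerDl.
by apply: sumr_ge0 => t _; exact: ler0n.
Qed.

Lemma measurable_frame_length :
  measurable_fun [set: Omega] (frame_length Z).
Proof.
apply: (emeasurable_fun_cvg (fun n w => (truncated_length n w)%:E)); last first.
  by move=> w _; exact: truncated_length_cvg.
move=> n.
exact/measurable_EFinP/(bounded_truncated_length n).1.
Qed.

Lemma frame_length_ge0 (w : Omega) : (0 <= frame_length Z w)%E.
Proof. by rewrite /frame_length; case: frame_stop. Qed.

Lemma truncated_length_le (n : nat) (w : Omega) :
  ((truncated_length n w)%:E <= frame_length Z w)%E.
Proof.
apply: cvge_to_ge (@truncated_length_cvg w) _; near=> m.
by apply: truncated_length_nd; near: m; exact: nbhs_infty_ge.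
Unshelve. all: by end_near. Qed.

Lemma integral_truncated_length (n : nat) :
  (\int[Pr]_w (truncated_length n w)%:E)%E =
  (\sum_(0 <= t < n) \int[Pr]_w (alive t w)%:R)%:E.
Proof.
rewrite -(RintegralT_sum _ _ bounded_alive) /Rintegral fineK//.
exact/integrable_fin_num/bounded_rv_integrable/bounded_truncated_length.
Qed.

Lemma integral_truncated_length_cvg :
  (\int[Pr]_w (truncated_length n w)%:E)%E @[n --> \oo] -->
  (\int[Pr]_w frame_length Z w)%E.
Proof.
rewrite (eq_integral (fun w => limn (fun n => (truncated_length n w)%:E))).
  apply: cvg_monotone_convergence => //.
  - by move=> n; exact/measurable_EFinP/(bounded_truncated_length n).1.
  - by move=> n w _; rewrite lee_fin; apply: sumr_ge0 => t _; exact: ler0n.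
  - by move=> w _ m n; exact: truncated_length_nd.
by move=> w _; rewrite (cvg_lim _ (@truncated_length_cvg w)).
Qed.

(** Monotone convergence applied to the bound of [expected_length_le], which is
    uniform in the truncation. *)
Lemma frame_length_integrable : Pr.-integrable [set: Omega] (frame_length Z).
Proof.
apply/integrableP; split; first exact: measurable_frame_length.
under eq_integral do rewrite gee0_abs ?frame_length_ge0//.
have slack_gt0 : 0 < lambda * (phi 0 - lambda) by rewrite mulr_gt0// subr_gt0.
apply: le_lt_trans (ltry (phi 0 / (lambda * (phi 0 - lambda)))).
apply: cvge_to_le integral_truncated_length_cvg _; apply: nearW => n.
rewrite integral_truncated_length lee_fin ler_pdivlMr// mulrC.
exact: expected_length_le.
Qed.

Lemma integral_frame_length_ge1 : (1 <= \int[Pr]_w frame_length Z w)%E.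
Proof.
apply: cvge_to_ge integral_truncated_length_cvg _; near=> n.
have n_gt0 : (0 < n)%N by near: n; exact: nbhs_infty_gt.
rewrite integral_truncated_length lee_fin -(RintegralT_sum _ _ bounded_alive).
rewrite -[leLHS](RintegralT_cst Pr); apply: RintegralT_le.
- exact: bounded_rv_cst.
- exact: bounded_truncated_length.
- move=> w; rewrite big_ltn// alive0 lerDl.
  by apply: sumr_ge0 => t _; exact: ler0n.
Unshelve. all: by end_near. Qed.

(** * Reward of a frame *)

Section reward.
Variables q x : R.
Hypotheses (q_ge0 : 0 <= q) (x_ge0 : 0 <= x).

Definition slot_reward (t : nat) (w : Omega) : R :=
  q * su_rate Z t w - x * power Z t w.

Lemma slot_reward_le (t : nat) (w : Omega) :
  `|slot_reward t w| <= q * mu_max + x * Pmax.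
Proof.
have Pt := power_in Z t w; have /andP[P_ge0 P_le] := PP_bounded Pt.
have /andP[m_ge0 m_le] := mu_su_bounded Pt.
have : 0 <= su_rate Z t w <= mu_max.
  by rewrite /su_rate; case: ifP => _; rewrite ?m_ge0 ?lexx//= (le_trans m_ge0).
move=> /andP[r_ge0 r_le]; rewrite /slot_reward (le_trans (ler_normB _ _))//.
by rewrite !normrM !ger0_norm// lerD// ler_wpM2l.
Qed.

Lemma measurable_su_rate (t : nat) : measurable_fun [set: Omega] (su_rate Z t).
Proof.
apply: measurable_fun_ifT => //; last exact: rate_measurable.
by apply: (measurable_fun_bool true); rewrite setTI; exact: measurable_idle.
Qed.

Lemma bounded_slot_reward (t : nat) : bounded_rv (slot_reward t).
Proof.
split; last by exists (q * mu_max + x * Pmax) => w; exact: slot_reward_le.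
apply: measurable_funB; apply: measurable_funM => //.
  exact: measurable_su_rate.
exact: measurable_power.
Qed.

(** [theta] and [c] are arbitrary until the theorem: every choice yields an
    identity for the reward of the frame. *)
Variables theta c : R.
Let rho := theta - c * lambda.

(** Summed over a frame, the queue terms cancel and the balances give
    reward - rho * length; in expectation, the queue terms turn each balance
    into the gain reward - theta + c * service ([Rintegral_slot_balance]). *)
Definition slot_balance (t : nat) (w : Omega) : R :=
  (alive t w)%:R * (slot_reward t w - rho -
                    c * ((arrival Z t w)%:R - (served Z t w)%:R)).

Lemma bounded_slot_balance (t : nat) : bounded_rv (slot_balance t).
Proof.
apply: bounded_rvM (bounded_alive t) _; apply: bounded_rvB.
  exact: bounded_rvB (bounded_slot_reward t) (bounded_rv_cst _ _).
exact: bounded_rvZ (bounded_rvB (bounded_arrival t) (bounded_served t)).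
Qed.

Lemma Rintegral_slot_balance (t : nat) :
  \int[Pr]_w slot_balance t w =
  \int[Pr]_w ((alive t w)%:R *
    (slot_reward t w - theta + c * service_prob t w)).
Proof.
have ba := bounded_alive t.
have br : bounded_rv (fun w => (alive t w)%:R * (slot_reward t w - rho)).
  apply: bounded_rvM ba _.
  exact: bounded_rvB (bounded_slot_reward t) (bounded_rv_cst _ _).
have bs := bounded_alive_service t.
have bf := bounded_flow t.
have bcl : bounded_rv (fun w => c * lambda * (alive t w)%:R).
  exact: bounded_rvZ.
have bcs : bounded_rv (fun w => c * ((alive t w)%:R * service_prob t w)).
  exact: bounded_rvZ.
have -> : \int[Pr]_w slot_balance t w =
    \int[Pr]_w ((alive t w)%:R * (slot_reward t w - rho) -
      c * ((alive t w)%:R * ((arrival Z t w)%:R - (served Z t w)%:R))).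
  by apply: eq_Rintegral => w _; rewrite /slot_balance; ring.
have -> : \int[Pr]_w ((alive t w)%:R *
      (slot_reward t w - theta + c * service_prob t w)) =
    \int[Pr]_w ((alive t w)%:R * (slot_reward t w - rho) -
      c * lambda * (alive t w)%:R + c * ((alive t w)%:R * service_prob t w)).
  by apply: eq_Rintegral => w _; rewrite /rho; ring.
rewrite RintegralT_B//; last exact: bounded_rvZ.
rewrite RintegralT_D//; last exact: bounded_rvB.
rewrite RintegralT_B// !RintegralT_Z// Rintegral_flow; ring.
Qed.

Lemma Rintegral_slot_balance_le0 (t : nat) :
  (forall w, alive t w ->
     slot_reward t w - theta + c * service_prob t w <= 0) ->
  \int[Pr]_w slot_balance t w <= 0.
Proof.
move=> gain_le0; rewrite Rintegral_slot_balance -(RintegralT_cst Pr 0).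
apply: RintegralT_le; last 2 first.
- exact: bounded_rv_cst.
- by move=> w; case: (boolP (alive t w)) => [/gain_le0|_];
    rewrite ?mul1r ?mul0r.
apply: bounded_rvM (bounded_alive t) _; apply: bounded_rvD.
  exact: bounded_rvB (bounded_slot_reward t) (bounded_rv_cst _ _).
exact/bounded_rvZ/bounded_service_prob.
Qed.

Lemma Rintegral_slot_balance_eq0 (t : nat) :
  (forall w, alive t w ->
     slot_reward t w - theta + c * service_prob t w = 0) ->
  \int[Pr]_w slot_balance t w = 0.
Proof.
move=> gain0; rewrite Rintegral_slot_balance -[RHS](RintegralT_cst Pr).
apply: eq_Rintegral => w _.
by case: (boolP (alive t w)) => [/gain0->|_]; rewrite ?mulr0 ?mul0r.
Qed.

Lemma sum_slot_balance (m n : nat) (w : Omega) :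
  frame_stop Z w = Some m -> (m <= n)%N ->
  \sum_(0 <= t < n) slot_balance t w =
  frame_reward Z q x w - rho * fine (frame_length Z w).
Proof.
move=> wm mn; rewrite /frame_reward /frame_length wm/=.
transitivity (\sum_(0 <= t < n) (alive t w)%:R * (slot_reward t w - rho) -
  c * \sum_(0 <= t < n)
    (alive t w)%:R * ((arrival Z t w)%:R - (served Z t w)%:R)).
  rewrite mulr_sumr -sumrB; apply: eq_bigr => t _.
  by rewrite /slot_balance; ring.
rewrite frame_flow (alive_stop _ wm) ltnNge mn mul0r mulr0 subr0.
by rewrite (frame_sum _ wm mn) sumrB sumr_const_nat subn0 mulr_natr.
Qed.

Lemma sum_slot_balance_le (n : nat) (w : Omega) :
  (`|(\sum_(0 <= t < n) slot_balance t w)%:E| <=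
   (q * mu_max + x * Pmax + `|rho| + `|c|)%:E * frame_length Z w)%E.
Proof.
set K := q * mu_max + _ + _ + _.
have K_ge0 : 0 <= K.
  have := le_trans (normr_ge0 _) (slot_reward_le 0 w).
  by move=> r_ge0; rewrite addr_ge0// addr_ge0.
apply: le_trans (lee_wpmul2l _ (truncated_length_le n w)); last by [].
rewrite lee_fin (le_trans (ler_norm_sum _ _ _))// mulr_sumr.
apply: ler_sum => t _; rewrite normrM ger0_norm ?ler0n// mulrC ler_wpM2r//.
rewrite (le_trans (ler_normB _ _))// lerD//.
  by rewrite (le_trans (ler_normB _ _))// lerD2r slot_reward_le.
rewrite normrM ler_piMr//.
by case: arrival; case: served;
  rewrite /= ?subrr ?subr0 ?sub0r ?normrN ?normr0 ?normr1.
Qed.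

(** On an unending frame both terms are 0, [fine] sending +oo to 0. *)
Let excess (w : Omega) : R :=
  frame_reward Z q x w - rho * fine (frame_length Z w).

Lemma frame_length_fin_num (w : Omega) :
  frame_length Z w \is a fin_num -> exists m, frame_stop Z w = Some m.
Proof. by rewrite /frame_length; case: frame_stop => // m _; exists m. Qed.

Lemma sum_slot_balance_cvg (w : Omega) : frame_length Z w \is a fin_num ->
  \sum_(0 <= t < n) slot_balance t w @[n --> \oo] --> excess w.
Proof.
move=> /frame_length_fin_num[m wm]; apply: cvg_near_cst; near=> n.
by apply: sum_slot_balance wm _; near: n; exact: nbhs_infty_ge.
Unshelve. all: by end_near. Qed.

Lemma measurable_excess : measurable_fun [set: Omega] excess.
Proof.
(* Restricted to the frames that end, the sums converge everywhere. *)
pose h n w : R := if frame_length Z w \is a fin_num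
  then \sum_(0 <= t < n) slot_balance t w else 0.
apply: (@measurable_fun_cvg _ _ _ _ h) => [n|w _].
  apply: measurable_fun_ifT => //.
    apply: (measurable_fun_bool true).
    exact: emeasurable_fin_num measurableT measurable_frame_length.
  exact: (bounded_rv_sum n bounded_slot_balance).1.
rewrite /h; have [fw|] := boolP (frame_length Z w \is a fin_num).
  exact: sum_slot_balance_cvg.
rewrite /excess /frame_reward /frame_length.
case: frame_stop => // _; rewrite mulr0 subr0; exact: cvg_cst.
Qed.

(** Dominated convergence of the truncated sums of balances, the bound being a
    multiple of the frame length ([sum_slot_balance_le]).  Almost every frame
    ends, and there the sums are eventually equal to [excess]. *)
Lemma frame_reward_balance :
  ('E_Pr[frame_reward Z q x] \is a fin_num)%E /\
  \sum_(0 <= t < n) \int[Pr]_w slot_balance t w @[n --> \oo] -->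
    fine 'E_Pr[frame_reward Z q x] - rho * fine (\int[Pr]_w frame_length Z w).
Proof.
have iT := frame_length_integrable.
have aefin := integrable_ae measurableT iT.
have [iex cex] : Pr.-integrable setT (EFin \o excess) /\
    (\int[Pr]_w (\sum_(0 <= t < n) slot_balance t w)%:E)%E @[n --> \oo] -->
    (\int[Pr]_w (excess w)%:E)%E.
  have [] := @dominated_convergence _ _ _ Pr setT measurableT
    (fun n w => (\sum_(0 <= t < n) slot_balance t w)%:E) (EFin \o excess)
    (fun w => (q * mu_max + x * Pmax + `|rho| + `|c|)%:E * frame_length Z w)%E.
  - move=> n.
    exact/measurable_EFinP/(bounded_rv_sum n bounded_slot_balance).1.
  - exact/measurable_EFinP/measurable_excess.
  - apply: filterS aefin => w /(_ I) fw _.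
    by apply: cvg_EFin; [exact: nearW|exact: sum_slot_balance_cvg].
  - exact: integrableZl.
  - by apply: nearW => w n _; exact: sum_slot_balance_le.
  - by move=> iex _ cex; split.
have iTfin : Pr.-integrable setT (EFin \o (fun w => fine (frame_length Z w))).
  apply: le_integrable iT => //.
    apply/measurable_EFinP; apply: measurableT_comp measurable_frame_length.
    exact: fine_measurable.
  by move=> w _; rewrite /frame_length /=; case: frame_stop => //; rewrite leey.
have fineT : \int[Pr]_w fine (frame_length Z w) =
    fine (\int[Pr]_w frame_length Z w)%E.
  congr fine; apply: ae_eq_integral => //.
  - by move/measurable_int : iTfin.
  - exact: measurable_frame_length.
  - by apply: filterS aefin => w fw /fw /fineK.
have iscale : Pr.-integrable setT
    (EFin \o (fun w => rho * fine (frame_length Z w))).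
  exact: integrableZl measurableT rho _ iTfin.
have rewardE : 'E_Pr[frame_reward Z q x]%E =
    (\int[Pr]_w excess w + rho * fine (\int[Pr]_w frame_length Z w)%E)%:E.
  rewrite unlock -fineT -RintegralZl// -RintegralD// /Rintegral fineK.
    by apply: eq_integral => w _; rewrite /excess subrK.
  apply: integrable_fin_num => //.
  apply: eq_integrable (integrableD measurableT iex iscale) => //.
rewrite rewardE; split=> //=; rewrite addrK.
rewrite (_ : (fun n => _) = fine \o
    (fun n => \int[Pr]_w (\sum_(0 <= t < n) slot_balance t w)%:E)%E).
  by apply: fine_cvg; rewrite /Rintegral fineK//; exact: integrable_fin_num.
by apply/funext => n; rewrite -(RintegralT_sum _ _ bounded_slot_balance).
Qed.

End reward.
End frame_integrals.

(** * Optimal ratio *)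

Lemma ratio_le (R : realType) (m : \bar R) (T : \bar R) (rho : R) :
  m \is a fin_num -> T \is a fin_num -> (0 < T)%E ->
  fine m - rho * fine T <= 0 -> (m / T <= rho%:E)%E.
Proof.
case: m => // m _; case: T => // T _; rewrite lte_fin /= => T_gt0.
by rewrite subr_le0 inver (gt_eqF T_gt0) lee_pdivrMr// lee_fin.
Qed.

Lemma ratio_eq (R : realType) (m : \bar R) (T : \bar R) (rho : R) :
  m \is a fin_num -> T \is a fin_num -> (0 < T)%E ->
  fine m - rho * fine T = 0 -> (m / T = rho%:E)%E.
Proof.
case: m => // m _; case: T => // T _; rewrite lte_fin /= => T_gt0 /eqP.
rewrite subr_eq0 inver (gt_eqF T_gt0) => /eqP ->.
by rewrite -EFinM mulfK// gt_eqF.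
Qed.

Theorem mainTheorem2 (R : realType)
  (PP : set R) (Pmax : R) (phi mu_su : R -> R) (mu_max lambda : R)
  (PP_bounded : forall p, PP p -> 0 <= p <= Pmax)
  (PP_0 : PP 0) (PP_max : PP Pmax)
  (phi_prob : forall p, PP p -> 0 <= phi p <= 1)
  (phi_nondecreasing :
     forall p p', PP p -> PP p' -> p <= p' -> phi p <= phi p')
  (mu_su_bounded : forall p, PP p -> 0 <= mu_su p <= mu_max)
  (mu_su_0 : mu_su 0 = 0)
  (lambda_gt0 : 0 < lambda) (lambda_lt : lambda < phi 0)
  (q x : R) (q_ge0 : 0 <= q) (x_ge0 : 0 <= x)
  (P0 theta P1 : R)
  (P0_in : PP P0)
  (P0_max : forall p, PP p -> q * mu_su p - x * p <= q * mu_su P0 - x * P0)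
  (theta_def : theta = q * mu_su P0 - x * P0)
  (P1_in : PP P1)
  (P1_min : forall p, PP p ->
     (theta + x * P1) / phi P1 <= (theta + x * p) / phi p)
  (d : measure_display) (Omega : measurableType d) (Pr : probability Omega R)
  (Z : controlled_frame PP phi mu_su lambda Pr)
  (Z_stationary : uses_stationary Z P0 P1)
  (d' : measure_display) (Omega' : measurableType d')
  (Pr' : probability Omega' R)
  (Z' : controlled_frame PP phi mu_su lambda Pr') :
  (frame_ratio Z' q x <= frame_ratio Z q x)%E.
Proof.
pose c := (theta + x * P1) / phi P1.
pose rho := theta - c * lambda.
have phi_gt0 p : PP p -> 0 < phi p.
  move=> Pp; apply: lt_le_trans (phi_nondecreasing _ _ PP_0 Pp _).
    exact: lt_trans lambda_lt.
  by case/andP: (PP_bounded _ Pp).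
have ratioP d0 (Om : measurableType d0) (Q : probability Om R)
    (Y : controlled_frame PP phi mu_su lambda Q) :=
  frame_reward_balance PP_bounded PP_0 phi_prob phi_nondecreasing
    mu_su_bounded lambda_gt0 lambda_lt Y q_ge0 x_ge0 theta c.
have lengthP d0 (Om : measurableType d0) (Q : probability Om R)
    (Y : controlled_frame PP phi mu_su lambda Q) :
    (\int[Q]_w frame_length Y w)%E \is a fin_num /\
    (0 < \int[Q]_w frame_length Y w)%E.
  split; last by apply: (lt_le_trans lte01); exact: integral_frame_length_ge1.
  apply: integrable_fin_num => //.
  exact: (frame_length_integrable PP_bounded).
(* Under the stationary policy every slot of the frame has gain 0. *)
have -> : frame_ratio Z q x = rho%:E.
  have [fin_reward balance] := ratioP _ _ _ Z.
  have [fin_length length_gt0] := lengthP _ _ _ Z.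
  apply: ratio_eq => //; apply: cvg_unique balance _ => //.
  rewrite (_ : (fun n => _) = fun=> 0); first exact: cvg_cst.
  apply/funext => n; rewrite big1// => t _.
  apply: (Rintegral_slot_balance_eq0 PP_bounded phi_prob phi_nondecreasing
    mu_su_bounded q_ge0 x_ge0) => w /asboolP in_t.
  have power_eq := Z_stationary _ _ in_t.
  rewrite /slot_reward /su_rate /service_prob /idle power_eq.
  case: eqP => _; first by rewrite mulr0 addr0 theta_def subrr.
  by rewrite mulr0 sub0r /c divfK ?gt_eqF ?phi_gt0//; ring.
(* Under an arbitrary policy no slot has a positive gain. *)
have [fin_reward balance] := ratioP _ _ _ Z'.
have [fin_length length_gt0] := lengthP _ _ _ Z'.
apply: ratio_le => //.
have sum_le0 n : \sum_(0 <= t < n)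
    \int[Pr']_w slot_balance Z' q x theta c t w <= 0.
  apply: sumr_le0 => t _.
  apply: (Rintegral_slot_balance_le0 PP_bounded phi_prob phi_nondecreasing
    mu_su_bounded q_ge0 x_ge0) => w _.
  have Pw := power_in Z' t w.
  rewrite /slot_reward /su_rate /service_prob /idle; case: ifP => _.
    by rewrite mulr0 addr0 subr_le0 theta_def P0_max.
  have := P1_min _ Pw; rewrite -/c ler_pdivlMr ?phi_gt0// mulr0.
  by lra.
by apply: cvgr_to_le balance _; exact: nearW.
Qed.
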